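(* Let $\mathbf{r}\ge 1$ be an integer, let $\phi:\mathbb{R}^n\to\mathbb{R}^n$ be of class $C^{\mathbf{r}}$, let $\tau>0$ and $u_0\in\mathbb{R}^n$, and let $p$ be an integer with $1\le p\le \mathbf{r}+1$. Consider the operator $\tilde g:\mathcal{C}^0([0,1],\mathbb{R}^n)\to\mathcal{C}^p([0,1],\mathbb{R}^n)$ defined by $$\tilde g(u)(t)=\sum_{q=0}^{p-1}\tau^q\frac{t^q}{q!}\phi^{[q]}(u_0)+\tau^p\int_0^t\frac{(t-s)^{p-1}}{(p-1)!}\phi^{[p]}(u(s))\,ds,\qquad t\in[0,1].$$ Then $u\in\mathcal{C}^0([0,1],\mathbb{R}^n)$ is a fixed point of $\tilde g$ if and only if $v:[0,\tau]\to\mathbb{R}^n$, $v(t)=u(t/\tau)$, is a solution of $$\frac{d^pv}{dt^p}(t)=\phi^{[p]}(v(t)),\ t\in[0,\tau],\qquad \frac{d^qv}{dt^q}(0)=\phi^{[q]}(u_0)\ \text{ for all } q=0,\dots,p-1,$$ and thus if and only if $v$ is a solution of the initial value problem $\frac{dv}{dt}(t)=\phi(v(t))$, $t\in[0,\tau]$, $v(0)=u_0$.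
   Context: The vector fields $\phi^{[q]}:\mathbb{R}^n\to\mathbb{R}^n$, $0\le q\le \mathbf{r}+1$, are defined recursively by $\phi^{[0]}(u)=u$ and $\phi^{[q+1]}(u)=D\phi^{[q]}(u)\,\phi(u)$ for all $u\in\mathbb{R}^n$ and $q=0,\dots,\mathbf{r}$ (so $\phi^{[1]}=\phi$, and $\phi^{[q]}$ is of class $C^{\mathbf{r}+1-q}$ for $q\ge1$). *)

(* Defs.v *)
From mathcomp Require Import all_boot all_order all_algebra.
From mathcomp Require Import all_classical all_reals all_analysis.
Import Order.TTheory GRing.Theory Num.Theory.
Import numFieldNormedType.Exports.

Set Implicit Arguments.
Unset Strict Implicit.
Unset Printing Implicit Defensive.

Local Open Scope classical_set_scope.
Local Open Scope ring_scope.

(* Since V is meant to be finite-dimensional, continuity (or C^k regularity)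
   of x |-> Df(x) amounts to that of x |-> Df(x)v for every vector v. *)
Fixpoint class_C {R : realType} {V W : normedModType R} (k : nat) (f : V -> W) :
    Prop :=
  if k is k'.+1 then
    (forall x, differentiable f x) /\
    (forall v, class_C k' (fun x => 'd f x v))
  else continuous f.

Fixpoint phi_iter {R : realType} {n : nat} (phi : 'rV[R]_n -> 'rV[R]_n)
    (q : nat) : 'rV[R]_n -> 'rV[R]_n :=
  if q is q'.+1 then fun u => 'd (phi_iter phi q') u (phi u) else id.

(* Functions on a segment A of the real line are represented by total
   functions on R of which only the values on A matter.  Derivatives are taken
   along A, hence are one-sided at the endpoints. *)
Definition quotient_in {R : realType} {n : nat} (f : R -> 'rV[R]_n) (t s : R) :
    'rV[R]_n := (s - t)^-1 *: (f s - f t).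

Definition derivable_in {R : realType} {n : nat} (A : set R)
    (f : R -> 'rV[R]_n) (t : R) : Prop :=
  cvg (quotient_in f t s @[s --> within A t^']).

Definition derive_in {R : realType} {n : nat} (A : set R)
    (f : R -> 'rV[R]_n) (t : R) : 'rV[R]_n :=
  lim (quotient_in f t s @[s --> within A t^']).

Definition deriven_in {R : realType} {n : nat} (A : set R) (k : nat)
    (f : R -> 'rV[R]_n) : R -> 'rV[R]_n := iter k (derive_in A) f.

Definition nderivable_in {R : realType} {n : nat} (A : set R) (k : nat)
    (f : R -> 'rV[R]_n) : Prop :=
  forall q, (q < k)%N -> forall t, A t -> derivable_in A (deriven_in A q f) t.

Definition class_C_in {R : realType} {n : nat} (A : set R) (k : nat)
    (f : R -> 'rV[R]_n) : Prop :=
  nderivable_in A k f /\ {within A, continuous (deriven_in A k f)}.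

(* The vector-valued integral is taken componentwise. *)
Definition gtilde {R : realType} {n : nat} (phi : 'rV[R]_n -> 'rV[R]_n)
    (tau : R) (u0 : 'rV[R]_n) (p : nat) (u : R -> 'rV[R]_n) (t : R) :
    'rV[R]_n :=
  \sum_(0 <= q < p) (tau ^+ q * (t ^+ q / q`!%:R)) *: phi_iter phi q u0
  + tau ^+ p *: \row_(i < n)
      \int[lebesgue_measure]_(s in `[0, t])
        ((t - s) ^+ p.-1 / (p.-1)`!%:R * phi_iter phi p (u s) ord0 i).

Definition solves_order {R : realType} {n : nat} (phi : 'rV[R]_n -> 'rV[R]_n)
    (tau : R) (u0 : 'rV[R]_n) (p : nat) (v : R -> 'rV[R]_n) : Prop :=
  [/\ nderivable_in `[0, tau] p v,
      forall t, 0 <= t <= tau ->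
        deriven_in `[0, tau] p v t = phi_iter phi p (v t)
    & forall q, (q < p)%N ->
        deriven_in `[0, tau] q v 0 = phi_iter phi q u0].

Definition solves_ivp {R : realType} {n : nat} (phi : 'rV[R]_n -> 'rV[R]_n)
    (tau : R) (u0 : 'rV[R]_n) (v : R -> 'rV[R]_n) : Prop :=
  [/\ forall t, 0 <= t <= tau -> derivable_in `[0, tau] v t,
      forall t, 0 <= t <= tau -> derive_in `[0, tau] v t = phi (v t)
    & v 0 = u0].

(* Main.v *)
From HB Require Import structures.
Require Import Defs.
From mathcomp Require Import all_boot all_order all_algebra.
From mathcomp Require Import all_classical all_reals all_analysis.
From mathcomp Require Import ring lra.
Import Order.TTheory GRing.Theory Num.Theory.
Import numFieldNormedType.Exports.

(** All derivatives are taken along a segment, hence are one-sided at its ends;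
    [has_deriv_in] records them as limits of difference quotients, and the usual
    rules (sum, product, chain rule, constancy) hold for them.  A jet of order [p] on
    [[0, T]] is a family [F 0, ..., F p] in which each function is the
    derivative of the preceding one; a jet computes the iterated derivatives of
    [F 0] ([jet_deriven_in]), and is determined by its last function and its
    initial values ([jet_unique]).

    The function [gtilde u] is the head of an explicit jet ([gtilde_jetP]): the
    derivative of the Taylor polynomial is a shifted Taylor polynomial, and the
    integral of [(t - s)^m / m! * h s] over [[0, t]] is an iterated primitive of
    [h], so that differentiating it lowers [m] by one.  Hence [gtilde u] is of
    class C^p, its p-th derivative is [tau^p phi^[p](u)], and its lower
    derivatives at 0 are [tau^q phi^[q](u0)].  After the change of time
    [t / tau], the fixed point equation states that [v] is the head of the jet
    with p-th function [phi^[p](v)] and initial values [phi^[q](u0)], which, by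
    uniqueness of jets, is the problem of order [p] ([gtilde_fixed_order]).

    If [v' = phi(v)], then the chain rule gives [v^(q) = phi^[q](v)] for all
    [q <= p], so [v] solves the problem of order [p].  Conversely, [phi^[p]] may
    be merely continuous when [p = r + 1], so uniqueness for the problem of
    order [p] is not available directly.  Instead, the defects
    [w_q = v^(q) - phi^[q](v)] satisfy [w_p = 0], [w_q(0) = 0] and
    [w_q' = w_{q+1} - D phi^[q](v) w_1] for [q < p]: this is a linear system
    with bounded coefficients, because [phi^[q]] is of class C^1 for [q <= r].
    A Gronwall argument ([linear_gronwall]) shows that all the defects vanish,
    and [w_1 = 0] is the equation [v' = phi(v)]. *)

Set Implicit Arguments.
Unset Strict Implicit.
Unset Printing Implicit Defensive.

Local Open Scope classical_set_scope.
Local Open Scope ring_scope.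

(** * Derivatives along a set *)

(** [l] is the derivative of [f] at [t] along [A]: only points of [A] enter the
    difference quotients, so the derivative is one-sided at the end of a
    segment. *)
Definition has_deriv_in {R : realType} {W : normedModType R} (A : set R)
    (f : R -> W) (t : R) (l : W) : Prop :=
  (s - t)^-1 *: (f s - f t) @[s --> within A t^'] --> l.

(** This makes derivatives along a nondegenerate segment unique. *)
Lemma punctured_segment_proper {R : realType} (T t : R) : 0 < T ->
  `[0, T]%classic t -> ProperFilter (within `[0, T] t^').
Proof.
move=> T0; rewrite /= in_itv /= => /andP[t0 tT].
apply: Build_ProperFilter_ex => P.
rewrite /dnbhs /within /= => nP.
have [tltT|Tlet] := ltP t T.
  near (t^'+) => s; exists s.
  have ts : t < s by near: s; exact: nbhs_right_gt.
  have sT : s < T by near: s; exact: nbhs_right_lt.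
  have : s != t -> s \in `[0, T] -> P s by near: s; exact: cvg_within.
  by apply; rewrite ?gt_eqF// in_itv /= (le_trans t0 (ltW ts)) ltW.
have tE : t = T by apply/eqP; rewrite eq_le tT.
near (t^'-) => s; exists s.
have st : s < t by near: s; exact: nbhs_left_lt.
have s0 : 0 < s by near: s; apply: nbhs_left_gt; rewrite tE.
have : s != t -> s \in `[0, T] -> P s by near: s; exact: cvg_within.
by apply; rewrite ?lt_eqF// in_itv /= (ltW s0) -tE ltW.
Unshelve. all: by end_near. Qed.

Section DerivIn.
Context {R : realType} {W : normedModType R} (A : set R).
Implicit Types (f g : R -> W) (t : R) (l : W).

(** A derivative along [A] depends only on the values on [A]. *)
Lemma has_deriv_in_eq f g t l : A t -> (forall s, A s -> f s = g s) ->
  has_deriv_in A f t l -> has_deriv_in A g t l.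
Proof.
move=> At fg; apply: cvg_trans; apply: near_eq_cvg.
apply: filterS (withinT _ _) => s As.
by rewrite !fg.
Qed.

Lemma has_deriv_in_cst (c : W) t : has_deriv_in A (fun=> c) t 0.
Proof.
rewrite /has_deriv_in; under eq_fun do rewrite subrr scaler0.
exact: cvg_cst.
Qed.

Lemma has_deriv_inD f g t l m : has_deriv_in A f t l -> has_deriv_in A g t m ->
  has_deriv_in A (fun s => f s + g s) t (l + m).
Proof.
move=> fl gm; rewrite /has_deriv_in.
under eq_fun do rewrite opprD addrACA scalerDr.
exact: cvgD.
Qed.

Lemma has_deriv_inZ (k : R) f t l : has_deriv_in A f t l ->
  has_deriv_in A (fun s => k *: f s) t (k *: l).
Proof.
move=> fl; rewrite /has_deriv_in.
under eq_fun do rewrite -scalerBr scalerA mulrC -scalerA.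
exact: cvgZr.
Qed.

Lemma has_deriv_inB f g t l m : has_deriv_in A f t l -> has_deriv_in A g t m ->
  has_deriv_in A (fun s => f s - g s) t (l - m).
Proof.
move=> fl gm; rewrite -(scaleN1r m).
under eq_fun do rewrite -(scaleN1r (g _)).
by apply: has_deriv_inD => //; exact: has_deriv_inZ.
Qed.

Lemma has_deriv_in_sum (I : Type) (r : seq I) (F : I -> R -> W) (L : I -> W) t :
  (forall i, has_deriv_in A (F i) t (L i)) ->
  has_deriv_in A (fun s => \sum_(i <- r) F i s) t (\sum_(i <- r) L i).
Proof.
move=> FL; elim: r => [|i r IH].
  by under eq_fun do rewrite big_nil; rewrite big_nil; exact: has_deriv_in_cst.
under eq_fun do rewrite big_cons; rewrite big_cons.
exact: has_deriv_inD.
Qed.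

Lemma has_deriv_in_cvg f t l : has_deriv_in A f t l ->
  f s @[s --> within A t^'] --> f t.
Proof.
move=> fl.
have : (s - t) *: ((s - t)^-1 *: (f s - f t)) + f t @[s --> within A t^']
    --> (t - t) *: l + f t.
  apply: cvgD; last exact: cvg_cst.
  apply: cvgZ => //; apply: cvgB; last exact: cvg_cst.
  by move=> P Pt; apply: cvg_within; exact: nbhs_dnbhs.
rewrite subrr scale0r add0r; apply: cvg_trans.
apply: near_eq_cvg.
have : within A t^' (fun s => s != t).
  by apply: (@cvg_within _ (t^')); exact: withinT.
apply: filterS => s st.
by rewrite scalerA mulfV ?subr_eq0// scale1r subrK.
Qed.

Lemma has_deriv_in_continuous f (f' : R -> W) :
  (forall t, A t -> has_deriv_in A f t (f' t)) -> {within A, continuous f}.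
Proof.
move=> ff'; apply/subspace_continuousP => t At.
have /has_deriv_in_cvg ft := ff' _ At.
move=> P Pt; have nP : nbhs t (fun s => s != t -> A s -> P (f s)) := ft P Pt.
suff : nbhs t (fun s => A s -> P (f s)) by [].
apply: filterS nP => s H As.
have [->|st] := eqVneq s t; last exact: H.
exact: nbhs_singleton.
Qed.

Lemma is_derive_has_deriv_in f t l :
  is_derive t 1 f l -> has_deriv_in A f t l.
Proof.
move=> [df fE].
have fl : h^-1 *: ((f \o shift t) (h *: 1) - f t) @[h --> 0^'] --> l.
  by rewrite -fE; exact: df.
move=> P /fl; rewrite /= !near_simpl => /nbhs_ballP[e /= e0 eP].
apply: cvg_within; apply/nbhs_ballP; exists e => //= s ts st.
have := eP (s - t); rewrite /= [_ *: 1]mulr1 subrK; apply.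
  by rewrite -ball_normE /= sub0r normrN distrC.
by rewrite subr_eq0.
Qed.

Lemma has_deriv_in_is_derive f t l : nbhs t A ->
  has_deriv_in A f t l -> is_derive t 1 f l.
Proof.
move=> At fl.
suff dl : h^-1 *: ((f \o shift t) (h *: 1) - f t) @[h --> 0^'] --> l.
  apply: DeriveDef; first by apply/cvg_ex; exists l.
  exact: cvg_lim dl.
move=> P Pl.
have nP : nbhs t (fun s => s != t -> A s -> P ((s - t)^-1 *: (f s - f t))) :=
  fl P Pl.
have [e /= e0 eP] := (nbhs_ballP t _).1 (filterI At nP).
apply/nbhs_ballP; exists e => //= h he h0.
have := eP (h + t); rewrite /= [_ *: 1]mulr1 addrK; case.
  move: he; rewrite -!ball_normE /= sub0r normrN opprD addrCA subrr addr0.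
  by rewrite normrN.
move=> Aht; apply => //.
by rewrite -subr_eq0 addrK.
Qed.

End DerivIn.

Lemma has_deriv_inM {R : realType} {W : normedModType R} (A : set R)
    (k : R -> R) (f : R -> W) t k' l :
  has_deriv_in A k t k' -> has_deriv_in A f t l ->
  has_deriv_in A (fun s => k s *: f s) t (k' *: f t + k t *: l).
Proof.
move=> kk' fl.
have : (s - t)^-1 *: (k s - k t) *: f t + k s *: ((s - t)^-1 *: (f s - f t))
    @[s --> within A t^'] --> k' *: f t + k t *: l.
  apply: cvgD; first by apply: cvgZ => //; exact: cvg_cst.
  by apply: cvgZ => //; exact: has_deriv_in_cvg kk'.
apply: cvg_trans; apply: near_eq_cvg; apply: nearW => s.
rewrite /= -[X in X *: f t]/(_ * _) -scalerA (scalerA (k s)) [k s * _]mulrC.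
rewrite -scalerA.
rewrite -scalerDr; congr (_ *: _).
by rewrite scalerBl scalerBr addrC addrA subrK.
Qed.

Lemma has_deriv_in_mxP {R : realType} {m n : nat} (A : set R)
    (f : R -> 'M[R]_(m, n)) t l :
  has_deriv_in A f t l <->
  forall i j, has_deriv_in A (fun s => f s i j) t (l i j).
Proof.
split=> [fl i j|fl].
  have : ((s - t)^-1 *: (f s - f t)) i j @[s --> within A t^'] --> l i j.
    exact: (cvg_comp _ _ fl (@coord_continuous _ _ _ i j l)).
  apply: cvg_trans; apply: near_eq_cvg; apply: nearW => s.
  by rewrite !mxE.
apply/cvgrPdist_le => /= e e0.
near=> s.
rewrite /Num.Def.normr/= mx_normrE (bigmax_le _ (ltW e0))//= => i _.
rewrite !mxE/=.
move: i; near: s; apply: filter_forall => /= i.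
exact: ((cvgrPdist_le _ _).1 (fl i.1 i.2)).
Unshelve. all: by end_near. Qed.

(** The chain rule, for an inner function differentiable along [A] only. *)
Lemma has_deriv_in_comp {R : realType} {V W : normedModType R} (A : set R)
    (f : R -> V) (g : V -> W) t l : A t ->
  has_deriv_in A f t l -> differentiable g (f t) ->
  has_deriv_in A (g \o f) t ('d g (f t) l).
Proof.
move=> At fl dg.
(* Outside A, f is replaced by its tangent line at t: the resulting function h
   is differentiable at t in the ordinary sense, with the same derivative. *)
pose h s := if s \in A then f s else f t + (s - t) *: l.
have hA s : A s -> h s = f s by move=> As; rewrite /h mem_set.
have ht : h t = f t by exact: hA.
have hl : has_deriv_in setT h t l.
  move=> P Pl.
  have nP : nbhs t (fun s => s != t -> A s -> P ((s - t)^-1 *: (f s - f t))) :=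
    fl P Pl.
  suff : nbhs t (fun s => s != t -> setT s -> P ((s - t)^-1 *: (h s - h t))).
    by [].
  apply: filterS nP => s H st _; rewrite ht /h.
  case: ifPn => [/set_mem|_]; first exact: H.
  rewrite [f t + _]addrC addrK scalerA mulVf ?subr_eq0// scale1r.
  exact: nbhs_singleton.
have [dh hE] := has_deriv_in_is_derive (@filterT _ _ _) hl.
have {}dh : differentiable h t by exact/derivable1_diffP.
rewrite -ht in dg *.
have dgh := differentiable_comp dh dg.
apply: (@has_deriv_in_eq _ _ _ (g \o h)) => // [s As|]; first by rewrite /= hA.
apply: is_derive_has_deriv_in; apply: DeriveDef.
  exact/derivable1_diffP.
by rewrite deriveE// diff_comp//= -hE deriveE.
Qed.

Lemma has_deriv_in_rescale {R : realType} {W : normedModType R} (A B : set R)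
    (c : R) (f : R -> W) t l : c != 0 -> (forall s, B s -> A (s / c)) ->
  has_deriv_in A f (t / c) l ->
  has_deriv_in B (fun s => f (s / c)) t (c^-1 *: l).
Proof.
move=> c0 BA fl.
have phi : s / c @[s --> within B t^'] --> within A (t / c)^'.
  move=> P nP.
  have {}nP : nbhs (t / c) (fun s => s != t / c -> A s -> P s) := nP.
  have nP' : nbhs t (fun s => s / c != t / c -> A (s / c) -> P (s / c)).
    have cv : s / c @[s --> t] --> t / c.
      by apply: cvgM; [exact: cvg_id|exact: cvg_cst].
    exact: cv nP.
  suff : nbhs t (fun s => s != t -> B s -> P (s / c)) by [].
  apply: filterS nP' => s H st Bs; apply: H (BA _ Bs).
  by rewrite (can_eq (divfK c0)).
have : c^-1 *: ((s / c - t / c)^-1 *: (f (s / c) - f (t / c)))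
    @[s --> within B t^'] --> c^-1 *: l.
  by apply: cvgZr; exact: (cvg_comp _ _ phi fl).
apply: cvg_trans; apply: near_eq_cvg; apply: nearW => s /=.
by rewrite scalerA -mulrBl invfM invrK mulrCA mulVf// mulr1.
Qed.

(** * Mean value inequality and Gronwall lemma *)

Lemma has_deriv_in_le0_nincr {R : realType} (T : R) (f f' : R -> R) :
  (forall t : R, 0 <= t <= T -> has_deriv_in `[0, T] f t (f' t)) ->
  (forall t : R, 0 <= t <= T -> f' t <= 0) ->
  forall t : R, 0 <= t <= T -> f t <= f 0.
Proof.
move=> ff' f'0 t /andP[t0 tT].
have cf : {within `[0, t], continuous f}.
  have := @has_deriv_in_continuous _ _ `[0, T] f f'.
  move=> /(_ _)/(continuous_subspaceW _); apply.
    by move=> s /=; rewrite !in_itv /= => /andP[-> /le_trans]; exact.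
  by move=> s /=; rewrite in_itv /=; exact: ff'.
have df s : s \in `]0, t[ -> is_derive s 1 f (f' s).
  rewrite in_itv /= => /andP[s0 st].
  apply: (@has_deriv_in_is_derive _ _ `[0, T]).
    apply: filterS (near_in_itvoo _ : \forall x \near s, x \in `]0, t[).
      move=> x /=; rewrite !in_itv /= => /andP[x0 xt].
      by rewrite (ltW x0) (le_trans (ltW xt)).
    by rewrite in_itv /= s0.
  by apply: ff'; rewrite (ltW s0) (le_trans (ltW st)).
have [c] := MVT_segment t0 df cf.
rewrite in_itv /= => /andP[c0 ct] E.
rewrite -subr_le0 E subr0 mulr_le0_ge0//.
by apply: f'0; rewrite c0 (le_trans ct).
Qed.

Lemma has_deriv_in0_cst {R : realType} {n : nat} (T : R) (f : R -> 'rV[R]_n) :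
  (forall t : R, 0 <= t <= T -> has_deriv_in `[0, T] f t 0) ->
  forall t : R, 0 <= t <= T -> f t = f 0.
Proof.
move=> f0 t tT; apply/rowP => i.
have fi0 (s : R) : 0 <= s <= T ->
    has_deriv_in `[0, T] (fun s => f s ord0 i) s 0.
  by move=> /f0/has_deriv_in_mxP/(_ ord0 i); rewrite mxE.
apply/eqP; rewrite eq_le; apply/andP; split.
  exact: (has_deriv_in_le0_nincr (f' := fun=> 0) fi0).
rewrite -lerN2.
apply: (has_deriv_in_le0_nincr (f := fun s => - f s ord0 i)
  (f' := fun=> 0) _ _ tT) => //.
move=> s sT; have := has_deriv_inZ (k := -1) (fi0 s sT).
rewrite scaler0; apply: has_deriv_in_eq => [|x _]; first by rewrite /= in_itv.
exact: mulN1r.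
Qed.

(** A finite family of functions vanishing at 0, whose derivatives are bounded
    by a multiple of the sum of their absolute values, vanishes. *)
Lemma linear_gronwall {R : realType} (I : finType) (T M : R)
    (x x' : I -> R -> R) : 0 <= M ->
  (forall i (t : R), 0 <= t <= T -> has_deriv_in `[0, T] (x i) t (x' i t)) ->
  (forall i (t : R), 0 <= t <= T -> `|x' i t| <= M * \sum_j `|x j t|) ->
  (forall i, x i 0 = 0) ->
  forall i (t : R), 0 <= t <= T -> x i t = 0.
Proof.
move=> M0 xx' x'M xi0.
(* The energy E satisfies E' <= K E, so exp(-K t) E(t) is nonincreasing. *)
pose E t := \sum_i x i t ^+ 2.
pose E' t := \sum_i (x i t * x' i t) *+ 2.
pose K : R := M * #|I|%:R *+ 2.
have E0 t : 0 <= E t by apply: sumr_ge0 => i _; exact: sqr_ge0.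
have EE' (t : R) : 0 <= t <= T -> has_deriv_in `[0, T] E t (E' t).
  move=> tT; apply: has_deriv_in_sum => i.
  have /(has_deriv_inM (xx' i t tT)) := xx' i t tT.
  by rewrite -[X in X + _]/(_ * _) -[X in _ + X]/(_ * _) mulrC -mulr2n.
have E'K (t : R) : 0 <= t <= T -> E' t <= K * E t.
  move=> tT.
  apply: (@le_trans _ _ (\sum_i \sum_j M * (x i t ^+ 2 + x j t ^+ 2))).
    (* |x_i x_i'| <= sum_j M |x_i| |x_j|, and 2 a b <= a^2 + b^2. *)
    apply: ler_sum => i _.
    apply: (@le_trans _ _ (`|x i t| * (M * \sum_j `|x j t|) *+ 2)).
      rewrite lerMn2r/=; apply: le_trans (ler_norm _) _.
      by rewrite normrM ler_wpM2l// x'M.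
    rewrite mulrCA mulr_sumr mulr_sumr -sumrMnl; apply: ler_sum => j _.
    rewrite -mulrnAr ler_wpM2l//.
    rewrite -(real_normK (num_real (x i t))) -(real_normK (num_real (x j t))).
    by rewrite -subr_ge0 addrAC -sqrrB sqr_ge0.
  under eq_bigr do rewrite -mulr_sumr big_split /= sumr_const -/(E t).
  rewrite -mulr_sumr big_split /= sumr_const sumrMnl -/(E t) -mulr2n.
rewrite -[X in _ * (X *+ 2)]mulr_natr /K.
  have -> : #|xpredT : pred I| = #|I| by exact: eq_card.
  by rewrite le_eqVlt; apply/orP; left; apply/eqP; ring.
pose h t := expR (- K * t) * E t.
have hh' (t : R) : 0 <= t <= T ->
    has_deriv_in `[0, T] h t (expR (- K * t) * (E' t - K * E t)).
  move=> tT; have e : has_deriv_in `[0, T] (fun s => expR (- K * s)) t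
      (- K * expR (- K * t)).
    apply: is_derive_has_deriv_in; apply: is_derive_eq.
    by rewrite [_%:A]mulr1 mulrC.
  have := has_deriv_inM e (EE' t tT).
  rewrite -[X in X + _]/(_ * _) -[X in _ + X]/(_ * _).
  rewrite (_ : _ + _ = expR (- K * t) * (E' t - K * E t))//.
  by ring.
move=> i t tT.
have ht : h t <= 0.
  have -> : 0 = h 0.
    rewrite /h /E big1 ?mulr0// => j _.
    by rewrite xi0 expr0n.
  apply: (has_deriv_in_le0_nincr hh') => // s sT.
  by rewrite mulr_ge0_le0 ?expR_ge0// subr_le0 E'K.
have {}ht : E t = 0.
  apply/eqP; rewrite eq_le E0 andbT.
  by move: ht; rewrite /h pmulr_rle0// expR_gt0.
apply/eqP; rewrite -sqrf_eq0.
by have /eqP := ht; rewrite psumr_eq0 => [/allP/(_ i (mem_index_enum _))//|j _];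
  rewrite sqr_ge0.
Qed.

(** * Functions of class C^k and the iterated vector fields *)

Section ClassC.
Context {R : realType} {V W : normedModType R}.

Lemma scale_is_bilinear :
  bilinear_for
    (GRing.Scale.Law.clone _ _ *:%R _) (GRing.Scale.Law.clone _ _ *:%R _)
    (fun (a : R) (w : W) => a *: w).
Proof.
split=> [w|a] k x y /=; first by rewrite scalerDl -scalerA.
by rewrite scalerDr !scalerA mulrC.
Qed.

(** The product rule for a scalar function times a vector function. *)
Lemma differentiableM_scale (k : V -> R) (g : V -> W) x :
  differentiable k x -> differentiable g x ->
  differentiable (fun y => k y *: g y) x /\
  (forall v, 'd (fun y => k y *: g y) x v = k x *: 'd g x v + 'd k x v *: g x).
Proof.
move=> dk dg.
pose sM := bilinear_isBilinear.Build R R W W _ _ _ scale_is_bilinear.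
pose s : {bilinear R -> W -> W} := HB.pack (fun (a : R) (w : W) => a *: w) sM.
have sc : continuous (fun p : R * W => s p.1 p.2) by exact: scale_continuous.
have dp : differentiable (fun y => (k y, g y)) x by exact: differentiable_pair.
have ds := @differentiable_bilin _ _ _ _ s (k x, g x) sc.
have E : (fun y => k y *: g y) =
  (fun p : R * W => s p.1 p.2) \o (fun y => (k y, g y)) by [].
rewrite E; split; first exact: differentiable_comp.
by move=> v; rewrite diff_comp//= (diff_bilin _ sc)/= diff_pair.
Qed.

Lemma class_C_continuous k (f : V -> W) : class_C k f -> continuous f.
Proof.
by case: k => //= k [df _] x; exact: differentiable_continuous.
Qed.

Lemma class_CW k (f : V -> W) : class_C k.+1 f -> class_C k f.
Proof.
elim: k f => [|k IH] f fC; first exact: class_C_continuous fC.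
by have [df dfC] := fC; split=> // v; exact: IH.
Qed.

Lemma class_C_le k m (f : V -> W) : (k <= m)%N -> class_C m f -> class_C k f.
Proof.
move=> km; rewrite -(subnK km); elim: (m - k)%N => // j IH /class_CW.
exact: IH.
Qed.

Lemma class_C_cst k (c : W) : class_C k (fun _ : V => c).
Proof.
elim: k c => [|k IH] c /=; first exact: cst_continuous.
split=> [x|v]; first exact: differentiable_cst.
rewrite (_ : (fun x => _) = fun=> 0)//; apply/funext => x.
by rewrite (diff_cst c x).
Qed.

Lemma class_C_add k (f g : V -> W) : class_C k f -> class_C k g ->
  class_C k (fun x => f x + g x).
Proof.
elim: k f g => [|k IH] f g /=.
  by move=> fc gc x; apply: cvgD; [exact: fc|exact: gc].
move=> [df fC] [dg gC]; split=> [x|v]; first exact: differentiableD.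
rewrite (_ : (fun x => _) = fun x => 'd f x v + 'd g x v); first exact: IH.
by apply/funext => x; rewrite (diffD (df x) (dg x)).
Qed.

Lemma class_C_sum k (I : Type) (r : seq I) (F : I -> V -> W) :
  (forall i, class_C k (F i)) -> class_C k (fun x => \sum_(i <- r) F i x).
Proof.
move=> FC; elim: r => [|i r IH].
  by under eq_fun do rewrite big_nil; exact: class_C_cst.
by under eq_fun do rewrite big_cons; exact: class_C_add.
Qed.

End ClassC.

Lemma class_C_scale {R : realType} {V W : normedModType R} {n : nat} k
    (f : V -> 'rV[R]_n) (g : V -> W) i :
  class_C k f -> class_C k g -> class_C k (fun x => f x ord0 i *: g x).
Proof.
elim: k f g => [|k IH] f g.
  move=> fc gc x; apply: cvgZ; last exact: gc.
  exact: (cvg_comp _ _ (fc x) (@coord_continuous _ _ _ _ _ _)).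
move=> fC gC; have [df dfC] := fC; have [dg dgC] := gC.
pose c (M : 'rV[R]_n) := M ord0 i.
have dc M : differentiable c M by exact: differentiable_coord.
have dfi x : differentiable (c \o f) x by exact: differentiable_comp.
have dfiE x v : 'd (c \o f) x v = 'd f x v ord0 i.
  rewrite diff_comp//=.
  have cl : linear c by move=> a u w; rewrite /c !mxE.
  pose cM := GRing.isLinear.Build _ _ _ _ _ cl.
  pose cL : {linear 'rV[R]_n -> R} := HB.pack c cM.
  by rewrite (@diff_lin _ _ _ cL)//; exact: coord_continuous.
split=> [x|v]; first by have [] := differentiableM_scale (dfi x) (dg x).
rewrite (_ : (fun x => _) =
    fun x => f x ord0 i *: 'd g x v + 'd f x v ord0 i *: g x).
  apply: class_C_add; first exact: IH (class_CW fC) (dgC v).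
  exact: IH (dfC v) (class_CW gC).
apply/funext => x.
by have [_ ->] := differentiableM_scale (dfi x) (dg x); rewrite dfiE.
Qed.

Lemma diff_sum_delta {R : realType} {n : nat} {W : normedModType R}
    (f : 'rV[R]_n -> W) x v :
  'd f x v = \sum_i v ord0 i *: 'd f x (delta_mx ord0 i).
Proof.
rewrite {1}(row_sum_delta v) linear_sum; apply: eq_bigr => i _.
by rewrite linearZ.
Qed.

Lemma phi_iter1 {R : realType} {n : nat} (phi : 'rV[R]_n -> 'rV[R]_n) :
  phi_iter phi 1%N = phi.
Proof. by apply: funext => u /=; rewrite diff_val. Qed.

(** In coordinates, [phi_iter q.+2] is the sum over [i] of the [i]-th coordinate
    of [phi] times the [i]-th partial derivative of [phi_iter q.+1], which costs
    one degree of regularity. *)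
Lemma class_C_phi_iter {R : realType} {n r : nat}
    (phi : 'rV[R]_n -> 'rV[R]_n) q :
  class_C r phi -> (q <= r)%N -> class_C (r - q) (phi_iter phi q.+1).
Proof.
move=> phiC; elim: q => [_|q IH qr]; first by rewrite subn0 phi_iter1.
have [_ dC] : class_C (r - q.+1).+1 (phi_iter phi q.+1).
  by rewrite -subSn// subSS; apply: IH; exact: ltnW.
have -> : phi_iter phi q.+2 = fun u => \sum_i phi u ord0 i *:
    'd (phi_iter phi q.+1) u (delta_mx ord0 i).
  by apply: funext => u; exact: diff_sum_delta.
apply: class_C_sum => i; apply: class_C_scale; last exact: dC.
by apply: class_C_le phiC; exact: leq_subr.
Qed.

Lemma phi_iter_continuous {R : realType} {n r : nat}
    (phi : 'rV[R]_n -> 'rV[R]_n) q :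
  class_C r phi -> (q <= r.+1)%N -> continuous (phi_iter phi q).
Proof.
case: q => [_ _ x|q phiC qr]; first exact: cvg_id.
exact: class_C_continuous (class_C_phi_iter phiC qr).
Qed.

Lemma phi_iter_C1 {R : realType} {n r : nat} (phi : 'rV[R]_n -> 'rV[R]_n) q :
  class_C r phi -> (q <= r)%N -> class_C 1%N (phi_iter phi q).
Proof.
case: q => [_ _|q phiC qr].
  split=> [x|v]; first by have [] := is_diff_id x.
  by under eq_fun do rewrite diff_val /=; exact: cst_continuous.
by apply: class_C_le (class_C_phi_iter phiC (ltnW qr)); rewrite subn_gt0.
Qed.

(** * Iterated primitives *)

Section Primitive.
Context {R : realType}.
Notation mu := (@lebesgue_measure R).
Implicit Types (h : R -> R).

Lemma continuous_integrable_segment h (a b : R) : continuous h ->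
  mu.-integrable `[a, b] (EFin \o h).
Proof.
move=> hc; apply: continuous_compact_integrable; first exact: segment_compact.
exact: continuous_subspaceT.
Qed.

Lemma has_deriv_in_primitive h (T t : R) : continuous h -> 0 <= t <= T ->
  has_deriv_in `[0, T] (fun t => \int[mu]_(s in `[0, t]) h s) t (h t).
Proof.
move=> hc /andP[t0 tT].
(* Starting the integral at -1 makes 0 an interior point, so that the
   fundamental theorem of calculus applies at every t >= 0. *)
pose G x := \int[mu]_(s in `[-1, x]) h s.
have GE x : 0 <= x -> G x - G 0 = \int[mu]_(s in `[0, x]) h s.
  move=> x0; rewrite /G Rintegral_itvB.
  - rewrite Rintegral_itv_obnd_cbnd//.
    apply: integrableS (continuous_integrable_segment 0 x hc) => //.
    exact: subset_itv_oc_cc.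
  - exact: continuous_integrable_segment.
  - by rewrite bnd_simp; lra.
  - by rewrite bnd_simp.
have GD : is_derive t 1 G (h t).
  have [||||dG GE'] := @continuous_FTC1_closed _ h (-1) t (t + 1).
  - by rewrite ltrDl.
  - exact: continuous_integrable_segment.
  - by apply: lt_le_trans t0; rewrite ltrN10.
  - exact: hc.
  by apply: DeriveDef => //; rewrite -derive1E.
apply: (@has_deriv_in_eq _ _ _ (fun x => G x - G 0)).
- by rewrite /= in_itv /= t0.
- by move=> x; rewrite /= in_itv /= => /andP[x0 _]; exact: GE.
rewrite -[h t]subr0; apply: has_deriv_inB; first exact: is_derive_has_deriv_in.
exact: has_deriv_in_cst.
Qed.

Lemma continuous_idM h : continuous h -> continuous (fun s : R => s * h s).
Proof. by move=> hc s; apply: cvgM; [exact: cvg_id|exact: hc]. Qed.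

Lemma continuous_powM h (t : R) m : continuous h ->
  continuous (fun s : R => (t - s) ^+ m * h s).
Proof.
move=> hc s; apply: cvgM; last exact: hc.
apply: (@continuous_comp _ _ _ (fun s => t - s) (fun y => y ^+ m)).
  by apply: cvgB; [exact: cvg_cst|exact: cvg_id].
exact: exprn_continuous.
Qed.

(** From [(t - s)^(m+1) = t (t - s)^m - (t - s)^m s]. *)
Lemma moment_rec h m (t : R) : continuous h ->
  \int[mu]_(s in `[0, t]) ((t - s) ^+ m.+1 * h s) =
  t * \int[mu]_(s in `[0, t]) ((t - s) ^+ m * h s) -
  \int[mu]_(s in `[0, t]) ((t - s) ^+ m * (s * h s)).
Proof.
move=> hc.
rewrite -RintegralZl//; last first.
  exact/continuous_integrable_segment/continuous_powM.
rewrite -RintegralB//.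
- by apply: eq_Rintegral => s _; rewrite exprS; ring.
- apply: continuous_integrable_segment => s; apply: cvgM; first exact: cvg_cst.
  exact: continuous_powM.
- exact/continuous_integrable_segment/continuous_powM/continuous_idM.
Qed.

(** Differentiation under the integral sign, by induction on [m] for all [h] at
    once: [moment_rec] removes [t] from one factor of the integrand. *)
Lemma has_deriv_in_moment h m (T t : R) : continuous h -> 0 <= t <= T ->
  has_deriv_in `[0, T] (fun t => \int[mu]_(s in `[0, t]) ((t - s) ^+ m * h s))
    t (if m is k.+1
       then k.+1%:R * \int[mu]_(s in `[0, t]) ((t - s) ^+ k * h s)
       else h t).
Proof.
move=> hc tT; elim: m h hc => [|m IH] h hc.
  rewrite (_ : (fun t => _) = fun t => \int[mu]_(s in `[0, t]) h s).
    exact: has_deriv_in_primitive.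
  by apply/funext => x; apply: eq_Rintegral => s _; rewrite expr0 mul1r.
rewrite (_ : (fun t => _) = fun t =>
    t * \int[mu]_(s in `[0, t]) ((t - s) ^+ m * h s) -
    \int[mu]_(s in `[0, t]) ((t - s) ^+ m * (s * h s))); last first.
  by apply/funext => x; exact: moment_rec.
have idt : has_deriv_in `[0, T] (fun s : R => s) t 1.
  exact: is_derive_has_deriv_in.
have := has_deriv_inB (has_deriv_inM idt (IH h hc))
  (IH _ (continuous_idM hc)).
rewrite -[X in has_deriv_in _ _ _ (X + _ - _)]/(_ * _).
rewrite -[X in has_deriv_in _ _ _ (_ + X - _)]/(_ * _).
congr (has_deriv_in _ _ _ _).
case: m {IH} => [|m]; first by rewrite addrK.
by rewrite (moment_rec m t hc); ring.
Qed.

End Primitive.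

Section Kernel.
Context {R : realType}.
Notation mu := (@lebesgue_measure R).

(** The function is extended by its boundary values. *)
Lemma within_continuous_extension (h : R -> R) :
  {within `[0, 1], continuous h} ->
  exists2 h', continuous h' & forall t : R, 0 <= t <= 1 -> h t = h' t.
Proof.
move=> /subspace_continuousP hc.
pose c (t : R) := Num.max 0 (Num.min t 1).
have c01 t : `[0, 1]%classic (c t).
  by rewrite /= in_itv /= /c le_max lexx ge_max ler01 ge_min lexx orbT.
have cc : continuous c.
  move=> t; apply: (@continuous_max _ R (cst 0) (fun s => Num.min s 1)).
    exact: cst_continuous.
  apply: (@continuous_min _ R id (cst 1)); first exact: cvg_id.
  exact: cst_continuous.
exists (h \o c) => [t|t /andP[t0 t1]]; last first.
  by rewrite /= /c (min_idPl t1) (max_idPr t0).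
move=> P /(hc _ (c01 t)) nP.
have {}nP : nbhs (c t) (fun s => `[0, 1]%classic s -> P (h s)) := nP.
have nc : nbhs t (fun s => `[0, 1]%classic (c s) -> P (h (c s))) := cc t _ nP.
suff : nbhs t (fun s => P (h (c s))) by [].
by apply: filterS nc => s; apply; exact: c01.
Qed.

(** The [m]-th iterated primitive of [h] from 0, given by the Cauchy formula for
    repeated integration when [m > 0]; it is meant for [t >= 0]. *)
Definition iterated_primitive (m : nat) (h : R -> R) (t : R) : R :=
  if m is k.+1 then \int[mu]_(s in `[0, t]) ((t - s) ^+ k / k`!%:R * h s)
  else h t.

Lemma iterated_primitive_eq m (h g : R -> R) (t : R) : 0 <= t <= 1 ->
  (forall s : R, 0 <= s <= 1 -> h s = g s) ->
  iterated_primitive m h t = iterated_primitive m g t.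
Proof.
move=> /andP[t0 t1] hg; case: m => [|m] /=; first by rewrite hg// t0.
apply: eq_Rintegral => s; rewrite inE /= in_itv /= => /andP[s0 st].
by rewrite hg// s0 (le_trans st).
Qed.

Lemma iterated_primitive0 m (h : R -> R) : iterated_primitive m.+1 h 0 = 0.
Proof. by rewrite /= set_itv1 Rintegral_set1. Qed.

Lemma has_deriv_in_iterated_primitive m (h : R -> R) (t : R) :
  {within `[0, 1], continuous h} -> 0 <= t <= 1 ->
  has_deriv_in `[0, 1] (iterated_primitive m.+1 h) t (iterated_primitive m h t).
Proof.
move=> /within_continuous_extension[g gc hg] t01.
rewrite (iterated_primitive_eq m t01 hg).
apply: (@has_deriv_in_eq _ _ _ (iterated_primitive m.+1 g)).
- by rewrite /= in_itv.
- by move=> s s01; rewrite (iterated_primitive_eq m.+1 _ hg)//.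
have E k : (fun x => iterated_primitive k.+1 g x) =
    (fun x => k`!%:R^-1 *: \int[mu]_(s in `[0, x]) ((x - s) ^+ k * g s)).
  apply/funext => x /=; rewrite -[RHS]/(_ * _) -RintegralZl//.
    by apply: eq_Rintegral => s _; rewrite -mulrA mulrCA.
  exact/continuous_integrable_segment/continuous_powM.
have := has_deriv_inZ (k := m`!%:R^-1) (has_deriv_in_moment (m := m) gc t01).
rewrite -E; congr (has_deriv_in _ _ _ _).
case: m => [|m]; first by rewrite /= invr1 scale1r.
rewrite -[RHS]/((fun x => iterated_primitive m.+1 g x) t) E.
rewrite -[LHS]/(_ * _) -[RHS]/(_ * _) mulrA; congr (_ * _).
by rewrite factS natrM invfM mulrAC mulVf ?mul1r// pnatr_eq0.
Qed.

End Kernel.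

(** The polynomial with [d] terms whose successive derivatives at 0 are
    [c 0, c 1, ...]. *)
Definition taylor_poly {R : realType} {W : normedModType R} (d : nat)
    (c : nat -> W) (t : R) : W :=
  \sum_(0 <= j < d) (t ^+ j / j`!%:R) *: c j.

Lemma has_deriv_in_taylor_poly {R : realType} {W : normedModType R} (A : set R)
    d (c : nat -> W) t :
  has_deriv_in A (taylor_poly d.+1 c) t (taylor_poly d (fun j => c j.+1) t).
Proof.
have -> : taylor_poly d.+1 c = fun t : R =>
    c 0 + \sum_(0 <= j < d) (t ^+ j.+1 / j.+1`!%:R) *: c j.+1.
  apply/funext => s; rewrite /taylor_poly big_nat_recl//.
  by rewrite expr0 divr1 scale1r.
rewrite -[X in has_deriv_in _ _ _ X]add0r.
apply: has_deriv_inD; first exact: has_deriv_in_cst.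
apply: has_deriv_in_sum => j.
have kj : has_deriv_in A (fun s : R => s ^+ j.+1 / j.+1`!%:R) t
    (t ^+ j / j`!%:R).
  have jE : is_derive t 1 (fun s : R => s ^+ j.+1) (j.+1%:R * t ^+ j).
    apply: DeriveDef; first exact: exprn_derivable.
    by rewrite exp_derive [_%:A]mulr1.
  have := has_deriv_inZ (k := j.+1`!%:R^-1) (is_derive_has_deriv_in A jE).
  rewrite [_ *: (_ * _)]mulrA factS natrM invfM [_ * _ * _%:R]mulrAC.
  rewrite mulVf ?pnatr_eq0//.
  rewrite mul1r [_ * t ^+ j]mulrC.
  by under eq_fun do rewrite [_ *: _]mulrC.
have := has_deriv_inM kj (has_deriv_in_cst A (c j.+1) t).
by rewrite scaler0 addr0.
Qed.

Lemma taylor_poly0 {R : realType} {W : normedModType R} d (c : nat -> W) :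
  taylor_poly d.+1 c (0 : R) = c 0.
Proof.
rewrite /taylor_poly big_nat_recl// big1 => [|j _].
  by rewrite expr0 divr1 scale1r addr0.
by rewrite expr0n mul0r scale0r.
Qed.

(** * Jets *)

(** [F 0, ..., F p] are successive derivatives on [[0, T]]. *)
Definition is_jet {R : realType} {n : nat} (T : R) (p : nat)
    (F : nat -> R -> 'rV[R]_n) : Prop :=
  forall q, (q < p)%N -> forall t : R, 0 <= t <= T ->
    has_deriv_in `[0, T] (F q) t (F q.+1 t).

Section Jet.
Context {R : realType} {n : nat} (T : R).
Hypothesis T0 : 0 < T.
Implicit Types (f : R -> 'rV[R]_n) (F G : nat -> R -> 'rV[R]_n).

Lemma jet_deriven_in p f F : is_jet T p F ->
  (forall t : R, 0 <= t <= T -> f t = F 0 t) ->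
  forall q, (q <= p)%N -> forall t : R, 0 <= t <= T ->
    deriven_in `[0, T] q f t = F q t.
Proof.
move=> jF f0; elim=> [_|q IH qp] t tT; first exact: f0.
have tA : `[0, T]%classic t by rewrite /= in_itv.
have pf := punctured_segment_proper T0 tA.
apply: cvg_lim => //.
apply: (has_deriv_in_eq (f := F q)) => //; last exact: jF.
by move=> s; rewrite /= in_itv /= => sT; rewrite -(IH (ltnW qp)).
Qed.

Lemma jet_nderivable_in p f F : is_jet T p F ->
  (forall t : R, 0 <= t <= T -> f t = F 0 t) -> nderivable_in `[0, T] p f.
Proof.
move=> jF f0 q qp t tA; have tT : 0 <= t <= T by rewrite /= in_itv in tA.
apply/cvg_ex; exists (F q.+1 t).
apply: (has_deriv_in_eq (f := F q)) => //; last exact: jF.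
by move=> s; rewrite /= in_itv /= => sT; rewrite (jet_deriven_in jF)// ltnW.
Qed.

Lemma nderivable_in_jet p f : nderivable_in `[0, T] p f ->
  is_jet T p (fun q => deriven_in `[0, T] q f).
Proof. by move=> df q qp t tT; apply: df; rewrite //= in_itv. Qed.

Lemma jet_unique p F G : is_jet T p F -> is_jet T p G ->
  (forall t : R, 0 <= t <= T -> F p t = G p t) ->
  (forall q, (q < p)%N -> F q 0 = G q 0) ->
  forall q, (q <= p)%N -> forall t : R, 0 <= t <= T -> F q t = G q t.
Proof.
move=> jF jG FGp FG0.
(* Downward induction on the order: F q - G q has derivative zero. *)
suff H k : (k <= p)%N -> forall t : R, 0 <= t <= T ->
    F (p - k)%N t = G (p - k)%N t.
  by move=> q qp; rewrite -(subKn qp); apply: H; exact: leq_subr.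
elim: k => [_|k IH kp] t tT; first by rewrite subn0 FGp.
have pk : (p - k.+1 < p)%N by rewrite ltn_subrL (leq_trans _ kp).
have D (s : R) : 0 <= s <= T ->
    has_deriv_in `[0, T] (fun s => F (p - k.+1)%N s - G (p - k.+1)%N s) s 0.
  move=> sT; have := has_deriv_inB (jF _ pk _ sT) (jG _ pk _ sT).
  by rewrite subnSK// (IH (ltnW kp))// subrr.
have := has_deriv_in0_cst D tT.
by rewrite FG0// subrr => /eqP; rewrite subr_eq0 => /eqP.
Qed.

(** The change of time [t / c]. *)
Lemma jet_rescale (c : R) p F : 0 < c -> is_jet T p F ->
  is_jet (T * c) p (fun q t => c^-1 ^+ q *: F q (t / c)).
Proof.
move=> c0 jF q qp t /andP[t0 tT].
rewrite exprSr -scalerA; apply: has_deriv_inZ.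
apply: (has_deriv_in_rescale (A := `[0, T])).
- by rewrite gt_eqF.
- move=> s; rewrite /= !in_itv /= => /andP[s0 sT].
  by rewrite divr_ge0 ?(ltW c0)//= ler_pdivrMr.
- by apply: jF => //; rewrite divr_ge0 ?(ltW c0)//= ler_pdivrMr.
Qed.

End Jet.

(** * The successive derivatives of [gtilde u] *)

Section Gtilde.
Context {R : realType} {n : nat} (phi : 'rV[R]_n -> 'rV[R]_n).
Variables (tau : R) (u0 : 'rV[R]_n) (p : nat) (u : R -> 'rV[R]_n).
Hypotheses (p0 : (0 < p)%N) (phic : continuous (phi_iter phi p)).
Hypothesis uc : {within `[0, 1], continuous u}.

(** An explicit formula for the [q]-th derivative of [gtilde phi tau u0 p u] on
    [[0, 1]], for [q <= p]. *)
Definition gtilde_jet (q : nat) (t : R) : 'rV[R]_n :=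
  taylor_poly (p - q) (fun j => tau ^+ (q + j) *: phi_iter phi (q + j) u0) t +
  tau ^+ p *: \row_i iterated_primitive (p - q)
    (fun s => phi_iter phi p (u s) ord0 i) t.

Lemma gtilde_jetE t : gtilde phi tau u0 p u t = gtilde_jet 0 t.
Proof.
rewrite /gtilde /gtilde_jet subn0; congr (_ + _ *: _).
  by apply: eq_bigr => j _; rewrite scalerA mulrC.
by apply/rowP => i; rewrite !mxE; case: (p) p0.
Qed.

Lemma phi_iter_within_continuous :
  {within `[0, 1], continuous (phi_iter phi p \o u)}.
Proof. by apply: within_continuous_comp => // x _; exact: phic. Qed.

Lemma gtilde_jetP : is_jet 1 p gtilde_jet.
Proof.
move=> q qp t t01; rewrite /gtilde_jet -(subnSK qp).
apply: has_deriv_inD.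
  have := has_deriv_in_taylor_poly `[0, 1] (d := (p - q.+1)%N)
    (c := fun j => tau ^+ (q + j) *: phi_iter phi (q + j) u0) (t := t).
  by under [X in taylor_poly _ X t]eq_fun do rewrite -addSnnS.
apply: has_deriv_inZ; apply/has_deriv_in_mxP => a i; rewrite ord1 !mxE.
rewrite (_ : (fun s => _) = iterated_primitive (p - q.+1).+1
    (fun s => phi_iter phi p (u s) ord0 i)); last first.
  by apply/funext => s; rewrite mxE.
apply: has_deriv_in_iterated_primitive => //.
have /subspace_continuousP vc := phi_iter_within_continuous.
apply/subspace_continuousP => s sA.
exact: (cvg_comp _ _ (vc s sA) (@coord_continuous _ _ _ _ _ _)).
Qed.

Lemma gtilde_jet0 q : (q < p)%N ->
  gtilde_jet q 0 = tau ^+ q *: phi_iter phi q u0.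
Proof.
move=> qp; rewrite /gtilde_jet -(subnSK qp) taylor_poly0 addn0.
rewrite (_ : \row_i _ = 0) ?scaler0 ?addr0//.
by apply/rowP => i; rewrite !mxE iterated_primitive0.
Qed.

Lemma gtilde_jet_last t : gtilde_jet p t = tau ^+ p *: phi_iter phi p (u t).
Proof.
rewrite /gtilde_jet subnn /taylor_poly big_geq// add0r; congr (_ *: _).
by apply/rowP => i; rewrite !mxE.
Qed.

Lemma gtilde_class_C_in : class_C_in `[0, 1] p (gtilde phi tau u0 p u).
Proof.
have E t : 0 <= t <= 1 -> gtilde phi tau u0 p u t = gtilde_jet 0 t.
  by move=> _; exact: gtilde_jetE.
split; first exact: jet_nderivable_in ltr01 _ _ _ gtilde_jetP E.
have E' (t : R) : `[0, 1]%classic t ->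
    deriven_in `[0, 1] p (gtilde phi tau u0 p u) t =
    tau ^+ p *: phi_iter phi p (u t).
  rewrite /= in_itv /= => t01.
  by rewrite (jet_deriven_in ltr01 gtilde_jetP)// gtilde_jet_last.
apply/subspace_continuousP => t tA.
suff H : deriven_in `[0, 1] p (gtilde phi tau u0 p u) s
    @[s --> within `[0, 1] (nbhs t)] --> tau ^+ p *: phi_iter phi p (u t).
  by rewrite -(E' t tA) in H.
have /subspace_continuousP/(_ t tA) vc := phi_iter_within_continuous.
have : tau ^+ p *: phi_iter phi p (u s) @[s --> within `[0, 1] (nbhs t)]
    --> tau ^+ p *: phi_iter phi p (u t) by exact: cvgZr.
apply: cvg_trans; apply: near_eq_cvg.
by apply: filterS (withinT _ _) => s sA; rewrite /= E'.
Qed.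

End Gtilde.

(** * The differential equations *)

Lemma within_continuous_bounded {R : realType} (T : R) (g : R -> R) :
  {within `[0, T], continuous g} ->
  exists2 M, 0 <= M & forall t : R, 0 <= t <= T -> `|g t| <= M.
Proof.
move=> gc; have := continuous_compact gc (@segment_compact _ _ _).
move=> /compact_bounded[N [_ NP]].
exists (Num.max 0 (N + 1)); first by rewrite le_max lexx.
move=> t tT; apply: le_trans (NP (N + 1) _ _ _) _.
- by rewrite ltrDl.
- by exists t => //=; rewrite in_itv.
- by rewrite le_max lexx orbT.
Qed.

Section InitialValueProblem.
Context {R : realType} {n r : nat} (phi : 'rV[R]_n -> 'rV[R]_n).
Variables (tau : R) (u0 : 'rV[R]_n) (v : R -> 'rV[R]_n).
Hypotheses (phiC : class_C r phi) (tau0 : 0 < tau).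

Lemma solves_ivp_order p : (p <= r.+1)%N ->
  solves_ivp phi tau u0 v -> solves_order phi tau u0 p v.
Proof.
move=> pr [dv v' v0].
have vD (t : R) : 0 <= t <= tau -> has_deriv_in `[0, tau] v t (phi (v t)).
  by move=> tT; rewrite -v'//; exact: dv.
have J : is_jet tau p (fun q t => phi_iter phi q (v t)).
  move=> q qp t tT.
  have [dphi _] := phi_iter_C1 phiC (leq_trans qp pr).
  apply: has_deriv_in_comp; [by rewrite /= in_itv|exact: vD|exact: dphi].
have vE (t : R) : 0 <= t <= tau -> v t = phi_iter phi 0 (v t) by [].
have tau00 : 0 <= (0 : R) <= tau by rewrite lexx ltW.
split; first exact: jet_nderivable_in tau0 _ _ _ J vE.
- by move=> t tT; rewrite (jet_deriven_in tau0 J vE).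
- by move=> q qp; rewrite (jet_deriven_in tau0 J vE)// ?v0// ltnW.
Qed.

Lemma diff_phi_iter_bounded p : (p <= r.+1)%N ->
  {within `[0, tau], continuous v} ->
  exists2 M, 0 <= M & forall q (i j : 'I_n) (t : R),
    (q < p)%N -> 0 <= t <= tau ->
    `|'d (phi_iter phi q) (v t) (delta_mx ord0 j) ord0 i| <= M.
Proof.
move=> pr vc.
pose g (k : 'I_p * 'I_n * 'I_n) (t : R) : R :=
  'd (phi_iter phi k.1.1) (v t) (delta_mx ord0 k.2) ord0 k.1.2.
have gM k : exists M, 0 <= M /\ forall t : R, 0 <= t <= tau -> `|g k t| <= M.
  suff /within_continuous_bounded[M M0 MP] :
      {within `[0, tau], continuous (g k)}.
    by exists M.
  have [_ /(_ (delta_mx ord0 k.2)) dc] :=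
    phi_iter_C1 phiC (leq_trans (ltn_ord k.1.1) pr).
  have /subspace_continuousP vc' := vc.
  apply/subspace_continuousP => s sA.
  have d1 := cvg_comp _ _ (vc' s sA) (dc (v s)).
  exact: (cvg_comp _ _ d1 (@coord_continuous _ _ _ _ _ _)).
have [m mP] := choice gM.
exists (\sum_k m k) => [|q i j t qp tT].
  by apply: sumr_ge0 => k _; have [] := mP k.
have [_ /(_ t tT)] := mP (Ordinal qp, i, j).
move=> /le_trans; apply.
rewrite (bigD1 (Ordinal qp, i, j))//= lerDl sumr_ge0// => k _.
by have [] := mP k.
Qed.

(** The defects [w q] between [v^(q)] and [phi^[q](v)] satisfy a homogeneous
    linear system with zero initial values. *)
Lemma solves_order_ivp p : (0 < p <= r.+1)%N ->
  solves_order phi tau u0 p v -> solves_ivp phi tau u0 v.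
Proof.
move=> /andP[p0 pr] [dv vp vq0].
pose F q := deriven_in `[0, tau] q v.
have jF : is_jet tau p F by exact: nderivable_in_jet.
have tA (t : R) : 0 <= t <= tau -> `[0, tau]%classic t by rewrite /= in_itv.
have vD (t : R) : 0 <= t <= tau -> has_deriv_in `[0, tau] v t (F 1%N t).
  exact: jF.
have vc : {within `[0, tau], continuous v}.
  apply: (has_deriv_in_continuous (f' := F 1%N)) => t.
  by rewrite /= in_itv /=; exact: vD.
have [M M0 MP] := diff_phi_iter_bounded pr vc.
pose w q t := F q t - phi_iter phi q (v t).
have wD q (t : R) : (q < p)%N -> 0 <= t <= tau ->
    has_deriv_in `[0, tau] (w q) t
      (w q.+1 t - 'd (phi_iter phi q) (v t) (w 1%N t)).
  move=> qp tT.
  have [dphi _] := phi_iter_C1 phiC (leq_trans qp pr).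
  have := has_deriv_inB (jF q qp t tT)
    (has_deriv_in_comp (tA t tT) (vD t tT) (dphi (v t))).
  congr (has_deriv_in _ _ _ _).
  rewrite /w phi_iter1 linearB /= opprB.
  by rewrite addrA subrK.
have wp (t : R) : 0 <= t <= tau -> w p t = 0.
  by move=> tT; rewrite /w /F vp// subrr.
have w0 q : (q <= p)%N -> w q 0 = 0.
  have tau00 : 0 <= (0 : R) <= tau by rewrite lexx ltW.
  rewrite leq_eqVlt => /predU1P[->|qp]; first exact: wp.
  by rewrite /w /F vq0// -[v 0]/(F 0%N 0) /F vq0// subrr.
(* The index p is included, with w p = 0, so that w q.+1 and w 1 belong to the
   family for every q < p. *)
pose x (k : 'I_p.+1 * 'I_n) (t : R) : R := w k.1 t ord0 k.2.
pose x' (k : 'I_p.+1 * 'I_n) (t : R) : R := if (k.1 < p)%N then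
  (w k.1.+1 t - 'd (phi_iter phi k.1) (v t) (w 1%N t)) ord0 k.2 else 0.
have xx' k (t : R) : 0 <= t <= tau -> has_deriv_in `[0, tau] (x k) t (x' k t).
  move=> tT; rewrite /x /x'; case: ifPn => kp.
    by have /has_deriv_in_mxP := wD _ _ kp tT; exact.
  have -> : (k.1 : nat) = p.
    by apply/eqP; rewrite eqn_leq -ltnS ltn_ord leqNgt.
  apply: has_deriv_in_eq (has_deriv_in_cst _ _ _); first exact: tA.
  by move=> s; rewrite /= in_itv /= => /wp ->; rewrite mxE.
have xle k (t : R) : `|x k t| <= \sum_j `|x j t|.
  by rewrite (bigD1 k)//= lerDl sumr_ge0.
have x1le (t : R) : \sum_j `|w 1%N t ord0 j| <= \sum_j `|x j t|.
  rewrite -(pair_bigA _ (fun q i => `|x (q, i) t|))/=.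
  have lt1p : (1 < p.+1)%N by [].
  by rewrite (bigD1 (Ordinal lt1p))//= lerDl sumr_ge0// => q _; exact: sumr_ge0.
have x'M k (t : R) : 0 <= t <= tau ->
    `|x' k t| <= (1 + M) * \sum_j `|x j t|.
  move=> tT; rewrite /x'; case: ifPn => kp; last first.
    by rewrite normr0 mulr_ge0 ?addr_ge0// sumr_ge0.
  have kp' : (k.1.+1 < p.+1)%N by [].
  rewrite mxE mulrDl mul1r; apply: le_trans (ler_normD _ _) _; apply: lerD.
    exact: (xle (Ordinal kp', k.2)).
  apply: le_trans (ler_wpM2l M0 (x1le t)).
  rewrite mxE normrN diff_sum_delta summxE mulr_sumr.
  apply: le_trans (ler_norm_sum _ _ _) _; apply: ler_sum => j _.
  by rewrite mxE normrM mulrC ler_wpM2r// MP.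
have x0 k : x k 0 = 0 by rewrite /x w0 ?mxE// -ltnS.
have xE := linear_gronwall (addr_ge0 ler01 M0) xx' x'M x0.
have F1 (t : R) : 0 <= t <= tau -> F 1%N t = phi (v t).
  move=> tT; apply/eqP; rewrite -subr_eq0 -(phi_iter1 phi).
  apply/eqP/rowP => i.
  have lt1p : (1 < p.+1)%N by [].
  by rewrite [RHS]mxE; exact: (xE (Ordinal lt1p, i) t tT).
split.
- by move=> t tT; exact: (dv 0%N p0 t (tA t tT)).
- by move=> t tT; exact: F1.
- exact: vq0 0%N p0.
Qed.

End InitialValueProblem.

Lemma gtilde_fixed_order {R : realType} {n : nat} (phi : 'rV[R]_n -> 'rV[R]_n)
    (tau : R) (u0 : 'rV[R]_n) (p : nat) (u : R -> 'rV[R]_n) :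
  0 < tau -> (0 < p)%N -> continuous (phi_iter phi p) ->
  {within `[0, 1], continuous u} ->
  (forall t, 0 <= t <= 1 -> u t = gtilde phi tau u0 p u t) <->
    solves_order phi tau u0 p (fun t => u (t / tau)).
Proof.
move=> tau0 p0 phic uc; set v := fun t => u (t / tau).
pose G q t := tau^-1 ^+ q *: gtilde_jet phi tau u0 p u q (t / tau).
have jG : is_jet tau p G.
  rewrite -[tau in is_jet tau]mul1r; apply: jet_rescale => //.
  exact: gtilde_jetP.
have tauq q (y : 'rV[R]_n) : tau^-1 ^+ q *: (tau ^+ q *: y) = y.
  by rewrite scalerA -exprMn mulVf ?gt_eqF// expr1n scale1r.
have G0 q : (q < p)%N -> G q 0 = phi_iter phi q u0.
  by move=> qp; rewrite /G mul0r gtilde_jet0.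
have Gp t : G p t = phi_iter phi p (v t) by rewrite /G gtilde_jet_last.
have Ggt t : G 0%N t = gtilde phi tau u0 p u (t / tau).
  by rewrite /G expr0 scale1r -gtilde_jetE.
have tau00 : 0 <= (0 : R) <= tau by rewrite lexx ltW.
split=> [fixu|[dv vp vq0]].
  have vG (t : R) : 0 <= t <= tau -> v t = G 0%N t.
    move=> /andP[t0 tT]; rewrite Ggt -fixu//.
    by rewrite divr_ge0 ?(ltW tau0)//= ler_pdivrMr// mul1r.
  split; first exact: jet_nderivable_in tau0 _ _ _ jG vG.
    by move=> t tT; rewrite (jet_deriven_in tau0 jG vG).
  by move=> q qp; rewrite (jet_deriven_in tau0 jG vG)// ?G0// ltnW.
have jF := nderivable_in_jet dv.
move=> t /andP[t0 t1].
have tE : t = t * tau / tau by rewrite mulfK// gt_eqF.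
rewrite {1 2}tE -Ggt -[LHS]/(deriven_in `[0, tau] 0 v (t * tau)).
apply: (jet_unique jF jG _ _ (leq0n p)).
- by move=> s sT; rewrite Gp vp.
- by move=> q qp; rewrite G0// vq0.
- by rewrite mulr_ge0 ?(ltW tau0)//= -[leRHS]mul1r ler_pM2r.
Qed.

Unset Implicit Arguments.

Theorem lemma2p4 (R : realType) (n r : nat) (hr : (1 <= r)%N)
  (phi : 'rV[R]_n -> 'rV[R]_n) (hphi : class_C r phi)
  (tau : R) (htau : 0 < tau) (u0 : 'rV[R]_n)
  (p : nat) (hp : (1 <= p <= r.+1)%N) :
  (forall u : R -> 'rV[R]_n, {within `[0, 1], continuous u} ->
     class_C_in `[0, 1] p (gtilde phi tau u0 p u)) /\
  (forall u : R -> 'rV[R]_n, {within `[0, 1], continuous u} ->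
     let v := fun t : R => u (t / tau) in
     ((forall t, 0 <= t <= 1 -> u t = gtilde phi tau u0 p u t) <->
        solves_order phi tau u0 p v) /\
     ((forall t, 0 <= t <= 1 -> u t = gtilde phi tau u0 p u t) <->
        solves_ivp phi tau u0 v)).
Proof.
have /andP[p0 pr] := hp.
have phic := phi_iter_continuous hphi pr.
split=> u uc; first exact: gtilde_class_C_in.
have FO := gtilde_fixed_order u0 htau p0 phic uc.
split; first exact: FO.
apply: (iff_trans FO); split; first exact: solves_order_ivp hphi htau _ hp.
exact: solves_ivp_order hphi htau _ pr.
Qed.
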